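(* Let $\Gamma;s$ be an extended context and $t_0,t_1,t_2$ terms. If $t_0\to_{\equiv}t_1$ and $\Gamma;s\vdash t_0\to_{\leq}t_2$, then for every extended context $\Gamma';s'$ with $\Gamma;s\rightarrowtail\Gamma';s'$ there exists a term $t_3$ such that $t_2\to_{\equiv}t_3$ and $\Gamma';s'\vdash t_1\to_{\leq}t_3$.
   Context: Terms: $t ::= x \mid \top \mid (\lambda x\leq t.u) \mid (u\,v)$, with $x$ from a countably infinite set of variables and $\top$ a constant; $x$ is bound in $u$ in $\lambda x\leq t.u$; terms identified up to renaming of bound variables; $\mathrm{fv}$ = free variables, $u[x:=v]$ = capture-avoiding substitution. Extended context $\Gamma;s$: a finite sequence $\Gamma$ of annotations $x\leq t$ and a finite list (stack) $s$ of terms; $\varepsilon;[]$ empty, $\Gamma,x\leq t;s$ appends an annotation, $\Gamma;\alpha::s$ pushes $\alpha$. $\mathrm{dom}(\Gamma)$ = annotated variables; $x\leq t\in\Gamma$ means the annotation occurs in $\Gamma$. Prevalidity: least predicate with $\varepsilon;[]$ prevalid; $\Gamma,x\leq t;[]$ prevalid if $\Gamma;[]$ prevalid, $x\notin\mathrm{dom}(\Gamma)$, $\mathrm{fv}(t)\subseteq\mathrm{dom}(\Gamma)$; $\Gamma;\alpha::s$ prevalid if $\Gamma;s$ prevalid and $\mathrm{fv}(\alpha)\subseteq\mathrm{dom}(\Gamma)$. Equivalence reduction $\to_{\equiv}$: least relation with $x\to_{\equiv}x$; $\top\to_{\equiv}\top$; $\top\,u\to_{\equiv}\top$; if $u\to_{\equiv}u'$,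 $v\to_{\equiv}v'$ then $u\,v\to_{\equiv}u'\,v'$ and $(\lambda x\leq t.u)\,v\to_{\equiv}u'[x:=v']$; if $t\to_{\equiv}t'$, $u\to_{\equiv}u'$ then $\lambda x\leq t.u\to_{\equiv}\lambda x\leq t'.u'$. Subtyping reduction $\Gamma;s\vdash u\to_{\leq}v$: least relation with (Prom) $\Gamma;s$ prevalid and $x\leq t\in\Gamma$ give $\Gamma;s\vdash x\to_{\leq}t$; (Top) $\Gamma;s$ prevalid gives $\Gamma;s\vdash u\to_{\leq}\top$; (Eq) $\Gamma;s$ prevalid and $u\to_{\equiv}v$ give $\Gamma;s\vdash u\to_{\leq}v$; (App) $\Gamma;v::s\vdash u\to_{\leq}u'$ gives $\Gamma;s\vdash u\,v\to_{\leq}u'\,v$; (FunOp) $\Gamma,x\leq\alpha;s\vdash u\to_{\leq}u'$ gives $\Gamma;\alpha::s\vdash\lambda x\leq t.u\to_{\leq}\lambda x\leq t.u'$; (Fun) $\Gamma,x\leq t;[]\vdash u\to_{\leq}u'$ gives $\Gamma;[]\vdash\lambda x\leq t.u\to_{\leq}\lambda x\leq t.u'$. Reduction of extended contexts $\Gamma;s\rightarrowtail\Gamma';s'$ is the least relation with: $\Gamma;s\rightarrowtail\Gamma;s$; if $\Gamma;s\rightarrowtail\Gamma';s'$ and $t\to_{\equiv}t'$ then $\Gamma,x\leq t;s\rightarrowtail\Gamma',x\leq t';s'$; if $\Gamma;s\rightarrowtail\Gamma';s'$ and $\alpha\to_{\equiv}\alpha'$ then $\Gamma;\alpha::s\ri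ghtarrowtail\Gamma';\alpha'::s'$.
   Formalization: Rule (FunOp) carries the extra side condition that the bound variable x is not free in the terms of the stack s (variable convention); without it x could be captured in s and the claim fails, e.g. for ε;[x] and (λx≤⊤.x)⊤. *)

(* Defs.v *)
From mathcomp Require Import all_boot.
From Stdlib Require List.

Set Implicit Arguments.
Unset Strict Implicit.
Unset Printing Implicit Defensive.

Definition var := nat.

(* Free variables are names, bound variables are de Bruijn indices (0 is the
   innermost binder); [tm n] may mention n enclosing binders.  Hence [tm 0]
   has exactly one element for each alpha-equivalence class of terms. *)
Inductive tm (n : nat) : Type :=
| BVar of 'I_n
| FVar of var
| Top
| Lam of tm n & tm n.+1
| App of tm n & tm n.

Arguments FVar {n} x.
Arguments Top {n}.

Definition term := tm 0.

Fixpoint fv n (u : tm n) : seq var :=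
  match u with
  | BVar _ => [::]
  | FVar x => [:: x]
  | Top => [::]
  | Lam t u => fv t ++ fv u
  | App u v => fv u ++ fv v
  end.

(* The binders added are the outermost ones, so indices do not change.  In
   the [Lam] case, [m <= n] and [m.+1 <= n.+1] are convertible. *)
Fixpoint widen_tm m n (le_mn : m <= n) (u : tm m) : tm n :=
  match u with
  | BVar i => BVar (widen_ord le_mn i)
  | FVar x => FVar x
  | Top => Top
  | Lam t u => Lam (widen_tm le_mn t) (@widen_tm m.+1 n.+1 le_mn u)
  | App u v => App (widen_tm le_mn u) (widen_tm le_mn v)
  end.

(* [subst x v u] is u[x:=v]. *)
Fixpoint subst (x : var) (v : term) n (u : tm n) : tm n :=
  match u with
  | BVar i => BVar i
  | FVar y => if y == x then widen_tm (leq0n n) v else FVar y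
  | Top => Top
  | Lam t u => Lam (subst x v t) (subst x v u)
  | App u w => App (subst x v u) (subst x v w)
  end.

(* Binds the name [x] by a new outermost binder, whose index is n here. *)
Fixpoint close (x : var) n (u : tm n) : tm n.+1 :=
  match u with
  | BVar i => BVar (widen_ord (leqnSn n) i)
  | FVar y => if y == x then BVar ord_max else FVar y
  | Top => Top
  | Lam t u => Lam (close x t) (close x u)
  | App u v => App (close x u) (close x v)
  end.

(* The abstraction binding the name [x] in [u], with bound [t].  By
   [lam_surj], every abstraction has this form, for every fresh [x]. *)
Definition lam (x : var) (t u : term) : term := Lam t (close x u).

Lemma fv_close x n (u : tm n) : fv (close x u) = [seq y <- fv u | y != x].
Proof.
elim: u => {n} //= [n y|n t IHt u IHu|n u IHu v IHv].
- by case: eqP.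
- by rewrite IHt IHu filter_cat.
- by rewrite IHu IHv filter_cat.
Qed.

Lemma fv_lam x t u : fv (lam x t u) = fv t ++ [seq y <- fv u | y != x].
Proof. by rewrite /= fv_close. Qed.

Lemma close_alpha x y n (u : tm n) :
  y \notin fv (close x u) -> close x u = close y (subst x (FVar y) u).
Proof.
elim: u => {n} //= [n z|n t IHt u IHu|n u IHu v IHv].
- case: eqP => [_|_] /=; first by rewrite eqxx.
  by rewrite inE eq_sym; case: eqP.
- by rewrite mem_cat negb_or => /andP[/IHt-> /IHu->].
- by rewrite mem_cat negb_or => /andP[/IHu-> /IHv->].
Qed.

Lemma lam_alpha x y t u :
  y \notin [seq z <- fv u | z != x] ->
  lam x t u = lam y t (subst x (FVar y) u).
Proof. by rewrite /lam -fv_close => /close_alpha->. Qed.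

Lemma close_surj x n (u : tm n.+1) :
  x \notin fv u -> exists v : tm n, u = close x v.
Proof.
move: n u; fix IH 2 => n [i|y||t u|u v] /=.
- move=> _; case: (ltnP i n) => [lt_in|le_ni].
    by exists (BVar (Ordinal lt_in)) => /=; congr BVar; apply: val_inj.
  exists (FVar x) => /=; rewrite eqxx; congr BVar; apply: val_inj => /=.
  by apply/eqP; rewrite eqn_leq le_ni -ltnS ltn_ord.
- by rewrite inE eq_sym => /negbTE yx; exists (FVar y) => /=; rewrite yx.
- by exists Top.
- rewrite mem_cat negb_or => /andP[/IH[t' ->] /IH[u' ->]].
  by exists (Lam t' u').
- rewrite mem_cat negb_or => /andP[/IH[u' ->] /IH[v' ->]].
  by exists (App u' v').
Qed.

Lemma lam_surj x (t : term) (u : tm 1) :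
  x \notin fv u -> exists u' : term, Lam t u = lam x t u'.
Proof. by move=> /(close_surj (n := 0))[u' ->]; exists u'. Qed.

Lemma fv_widen_tm m n (le_mn : m <= n) (u : tm m) : fv (widen_tm le_mn u) = fv u.
Proof.
elim: u n le_mn => {m} //= [m t IHt u IHu|m u IHu v IHv] n le_mn.
- by rewrite IHt (IHu n.+1).
- by rewrite IHu IHv.
Qed.

Lemma close_widen_tm x m n (le_mn : m <= n) (le_mSn : m <= n.+1) (u : tm m) :
  x \notin fv u -> close x (widen_tm le_mn u) = widen_tm le_mSn u.
Proof.
elim: u n le_mn le_mSn => {m} //= [m i|m y|m t IHt u IHu|m u IHu v IHv] n le_mn le_mSn.
- by move=> _; congr BVar; apply: val_inj.
- by rewrite inE eq_sym => /negbTE->.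
- rewrite mem_cat negb_or => /andP[xt xu].
  by rewrite (IHt _ _ le_mSn xt) (IHu n.+1 _ le_mSn xu).
- rewrite mem_cat negb_or => /andP[xu xv].
  by rewrite (IHu _ _ le_mSn xu) (IHv _ _ le_mSn xv).
Qed.

Lemma subst_close x y v n (u : tm n) : y != x -> y \notin fv v ->
  subst x v (close y u) = close y (subst x v u).
Proof.
move=> yx yv; elim: u => {n} //= [n z|n t -> u ->|n u -> w ->] //.
have [->|zy] := eqVneq z y; first by rewrite (negbTE yx) /= eqxx.
rewrite /=; case: eqP => _ /=; last by rewrite (negbTE zy).
by rewrite (close_widen_tm _ (leq0n n.+1)).
Qed.

Lemma subst_lam x v y t u : y != x -> y \notin fv v ->
  subst x v (lam y t u) = lam y (subst x v t) (subst x v u).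
Proof. by move=> yx yv; rewrite /lam /= subst_close. Qed.

(* Most recent annotation first: Γ, x ≤ t is [(x, t) :: G]. *)
Definition ctx := seq (var * term).
Definition stack := seq term.

Definition dom (G : ctx) : seq var := map fst G.

Inductive prevalid : ctx -> stack -> Prop :=
| pv_empty : prevalid [::] [::]
| pv_ctx G x t :
    prevalid G [::] -> x \notin dom G -> {subset fv t <= dom G} ->
    prevalid ((x, t) :: G) [::]
| pv_stack G s a :
    prevalid G s -> {subset fv a <= dom G} ->
    prevalid G (a :: s).

Inductive eqred : term -> term -> Prop :=
| eqred_var x : eqred (FVar x) (FVar x)
| eqred_top : eqred Top Top
| eqred_topapp u : eqred (App Top u) Top
| eqred_app u u' v v' :
    eqred u u' -> eqred v v' -> eqred (App u v) (App u' v')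
| eqred_beta x t u u' v v' :
    eqred u u' -> eqred v v' -> eqred (App (lam x t u) v) (subst x v' u')
| eqred_lam x t t' u u' :
    eqred t t' -> eqred u u' -> eqred (lam x t u) (lam x t' u').

(* In (FunOp), the bound name [x] is chosen fresh for the rest of the judgment.
   For [dom G] and [a] this follows from the prevalidity of the context in the
   premise; for [s] it must be required, since otherwise the [x] annotated in
   the premise would capture occurrences of [x] in [s]. *)
Inductive subred : ctx -> stack -> term -> term -> Prop :=
| subred_prom G s x t :
    prevalid G s -> List.In (x, t) G -> subred G s (FVar x) t
| subred_top G s u :
    prevalid G s -> subred G s u Top
| subred_eq G s u v :
    prevalid G s -> eqred u v -> subred G s u v
| subred_app G s u u' v :
    subred G (v :: s) u u' -> subred G s (App u v) (App u' v)
| subred_funop G s x a t u u' :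
    all (fun b : term => x \notin fv b) s ->
    subred ((x, a) :: G) s u u' ->
    subred G (a :: s) (lam x t u) (lam x t u')
| subred_fun G x t u u' :
    subred ((x, t) :: G) [::] u u' ->
    subred G [::] (lam x t u) (lam x t u').

Inductive ectxred : ctx -> stack -> ctx -> stack -> Prop :=
| ectxred_refl G s : ectxred G s G s
| ectxred_ctx G s G' s' x t t' :
    ectxred G s G' s' -> eqred t t' ->
    ectxred ((x, t) :: G) s ((x, t') :: G') s'
| ectxred_stack G s G' s' a a' :
    ectxred G s G' s' -> eqred a a' ->
    ectxred G (a :: s) G' (a' :: s').

(* Main.v *)
(* Since [(\x<=t.u) v] pushes [v] on the stack, (FunOp) reduces the body [u]
   under the annotation [x <= v]; contracting the redex then replaces a
   promotion of [x] to [v] by the trivial step [v -> v].  Thus subtyping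
   reduction is stable under substituting a variable by its bound, which joins
   a beta step with a reduction inside the abstraction.  All inductions on
   terms are on the size, so that bound names can be changed freely. *)
Require Import Defs.
From mathcomp Require Import all_boot.
From mathcomp Require Import zify.
From Stdlib Require List.

Set Implicit Arguments.
Unset Strict Implicit.
Unset Printing Implicit Defensive.

(** * Names, sizes and substitution *)

Fixpoint tm_size n (u : tm n) : nat :=
  match u with
  | BVar _ | FVar _ | Top => 1
  | Lam t u => (tm_size t + tm_size u).+1
  | App u v => (tm_size u + tm_size v).+1
  end.

Lemma tm_size_close x n (u : tm n) : tm_size (close x u) = tm_size u.
Proof.
elim: u => {n} //= [n y|n t -> u ->|n u -> v ->] //.
by case: eqP.
Qed.

(** Keeps an induction hypothesis on sizes available for a body whose bound name has just been
    changed. *)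
Lemma tm_size_rename x y n (u : tm n) :
  tm_size (subst x (FVar y) u) = tm_size u.
Proof.
elim: u => {n} //= [n z|n t -> u ->|n u -> v ->] //.
by case: eqP.
Qed.

Lemma exists_fresh (l : seq var) : exists x : var, x \notin l.
Proof.
exists (\max_(i <- l) i).+1; apply/negP => xl.
by have := @leq_bigmax_seq _ l xpredT id _ xl isT; rewrite ltnn.
Qed.

Lemma fv_subst x v y n (u : tm n) :
  y \in fv (subst x v u) -> y \in fv v \/ y \in fv u /\ y != x.
Proof.
elim: u => {n} //= [n z|n t IHt u IHu|n u IHu w IHw].
- case: eqP => [_|/eqP zx]; first by rewrite fv_widen_tm; left.
  by rewrite inE => /eqP->; right; rewrite eqxx.
- by rewrite !mem_cat => /orP[/IHt|/IHu] [|[-> ->]]; rewrite ?orbT; auto.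
- by rewrite !mem_cat => /orP[/IHu|/IHw] [|[-> ->]]; rewrite ?orbT; auto.
Qed.

Lemma subst_app x v n (u w : tm n) :
  subst x v (App u w) = App (subst x v u) (subst x v w).
Proof. by []. Qed.

Lemma subst_fresh x v n (u : tm n) : x \notin fv u -> subst x v u = u.
Proof.
elim: u => {n} //= [n z|n t IHt u IHu|n u IHu w IHw].
- by rewrite inE eq_sym => /negbTE->.
- by rewrite mem_cat negb_or => /andP[/IHt-> /IHu->].
- by rewrite mem_cat negb_or => /andP[/IHu-> /IHw->].
Qed.

Lemma widen_tm_id n (nn : n <= n) (u : tm n) : widen_tm nn u = u.
Proof.
elim: u nn => {n} //= [n i|n t IHt u IHu|n u IHu w IHw] nn.
- by congr BVar; apply: val_inj.
- by rewrite IHt (IHu nn).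
- by rewrite IHu IHw.
Qed.

Lemma widen_tm_trans m n p (mn : m <= n) (np : n <= p) (mp : m <= p) (u : tm m) :
  widen_tm np (widen_tm mn u) = widen_tm mp u.
Proof.
elim: u n p mn np mp => {m} //= [m i|m t IHt u IHu|m u IHu w IHw] n p mn np mp.
- by congr BVar; apply: val_inj.
- by rewrite (IHt _ _ _ _ mp) (IHu n.+1 p.+1 _ _ mp).
- by rewrite (IHu _ _ _ _ mp) (IHw _ _ _ _ mp).
Qed.

Lemma subst_widen_tm x v m n (mn : m <= n) (u : tm m) :
  subst x v (widen_tm mn u) = widen_tm mn (subst x v u).
Proof.
elim: u n mn => {m} //= [m z|m t IHt u IHu|m u IHu w IHw] n mn.
- by case: eqP => // _; rewrite (widen_tm_trans _ _ (leq0n n)).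
- by rewrite IHt (IHu n.+1 mn).
- by rewrite IHu IHw.
Qed.

Lemma subst_subst x v z w n (u : tm n) : z != x -> z \notin fv v ->
  subst x v (subst z w u) = subst z (subst x v w) (subst x v u).
Proof.
move=> zx zv; elim: u => {n} //= [n y|n t -> u ->|n u -> r ->] //.
have [->|yz] := eqVneq y z.
  by rewrite (negbTE zx) /= eqxx subst_widen_tm.
rewrite /=; case: eqP => _ /=; last by rewrite (negbTE yz).
by rewrite subst_fresh // fv_widen_tm.
Qed.

(** The hypothesis covers a fresh [x] as well as the trivial renaming [x = y]: these are the two
    ways in which one abstraction can be presented with names [x] and [y]. *)
Lemma subst_rename x y v n (u : tm n) : (x \in fv u -> x = y) ->
  subst x v (subst y (FVar x) u) = subst y v u.
Proof.
elim: u => {n} //= [n z|n t IHt u IHu|n u IHu w IHw] xP.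
- case: eqP => [_|zy] /=; first by rewrite eqxx.
  by case: eqP => // zx; case: zy; rewrite zx; apply: xP; rewrite zx inE.
- by rewrite IHt ?IHu // => xu; apply: xP; rewrite mem_cat xu ?orbT.
- by rewrite IHu ?IHw // => xu; apply: xP; rewrite mem_cat xu ?orbT.
Qed.

(** The index [ord_max] that replaces [x] differs from every widened index, so closing loses no
    information. *)
Lemma close_inj x n : injective (@close x n).
Proof.
move=> u; elim: u => {n} [n i|n y|n|n t IHt u IHu|n u IHu v IHv] [j|z||t' u'|u' v'] //=;
  do ?case: eqP => //.
- by move=> [ij]; congr BVar; apply: val_inj.
- by move=> _ [ij]; have := ltn_ord i; rewrite ij ltnn.
- by move=> _ [ij]; have := ltn_ord j; rewrite -ij ltnn.
- by move=> -> ->.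
- by move=> _ _ [->].
- by move=> [/IHt-> /IHu->].
- by move=> [/IHu-> /IHv->].
Qed.

(** Since [x] is not free in the common closure, [w] can be renamed to use [x], and injectivity of
    [close x] identifies the bodies. *)
Lemma close_eq_rename x y n (u w : tm n) : close x u = close y w ->
  u = subst y (FVar x) w /\ (x \in fv w -> x = y).
Proof.
move=> e; have xw : x \notin fv (close y w).
  by rewrite -e fv_close mem_filter eqxx.
split; first by apply: (@close_inj x); rewrite e; apply: close_alpha.
move: xw; rewrite fv_close mem_filter negb_and negbK => /orP[/eqP//|].
by move/negbTE->.
Qed.

(** * Equivalence reduction *)

(** The body of a [Lam] lies in [tm 1] and becomes a term only once a name is chosen; the result is
    not a structural subterm, but it is smaller. *)
Lemma eqred_refl u : eqred u u.
Proof.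
have [k] := ubnP (tm_size u); elim: k u => // k IH [[]//|x||t u|u v] /= lt_k.
- exact: eqred_var.
- exact: eqred_top.
- have [x /(lam_surj t)[u' e]] := exists_fresh (fv u).
  rewrite e; move: e => [eu]; rewrite eu tm_size_close in lt_k.
  by apply: eqred_lam; apply: IH; lia.
- by apply: eqred_app; apply: IH; lia.
Qed.

Lemma eqred_fv u u' : eqred u u' -> {subset fv u' <= fv u}.
Proof.
elim=> {u u'} /=.
- by move=> x.
- by [].
- by [].
- move=> u u' v v' _ IHu _ IHv y; rewrite !mem_cat.
  by move=> /orP[/IHu|/IHv] ->; rewrite ?orbT.
- move=> x t u u' v v' _ IHu _ IHv y /fv_subst; rewrite !mem_cat fv_close.
  by rewrite mem_filter => -[/IHv->|[/IHu-> ->]]; rewrite !orbT.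
- move=> x t t' u u' _ IHt _ IHu y; rewrite !mem_cat !fv_close !mem_filter.
  by move=> /orP[/IHt->//|/andP[-> /IHu->]]; rewrite orbT.
Qed.

Lemma eqred_subst x v v' u u' :
  eqred v v' -> eqred u u' -> eqred (subst x v u) (subst x v' u').
Proof.
have [k] := ubnP (tm_size u).
elim: k x v v' u u' => // k IH x v v' u0 u0' lt_k vv' uu'.
case: uu' lt_k => [y||w|u u' w w' uu' ww'|y t u u' w w' uu' ww'|y t t' u u' tt' uu'].
- move=> _ /=; case: eqP => _; last exact: eqred_var.
  by rewrite !widen_tm_id.
- by move=> _; apply: eqred_top.
- by move=> _; apply: eqred_topapp.
- by move=> /= lt_k; apply: eqred_app; apply: IH => //; lia.
- move=> lt_k; rewrite /= tm_size_close in lt_k.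
  have [z] := exists_fresh (x :: fv u ++ fv u' ++ fv v ++ fv v').
  rewrite inE !mem_cat !negb_or => /and5P[zx zu zu' zv zv'].
  (* Both the abstraction and the contractum are rewritten over the fresh name [z], so that
     substitution commutes with the binder and with the contraction. *)
  rewrite (@lam_alpha y z); last by rewrite mem_filter negb_and zu orbT.
  rewrite -(@subst_rename z y w') ?(negbTE zu') // subst_subst //.
  rewrite subst_app subst_lam //.
  apply: eqred_beta; last by apply: IH => //; lia.
  (* The inner use of the induction hypothesis renames [y] to [z] in both bodies; the outer one
     substitutes for [x]. *)
  by apply: (IH); rewrite ?tm_size_rename; [lia|by []|apply: IH => //; [lia|apply: eqred_var]].
- move=> lt_k; rewrite /= tm_size_close in lt_k.
  have [z] := exists_fresh (x :: fv u ++ fv u' ++ fv v ++ fv v').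
  rewrite inE !mem_cat !negb_or => /and5P[zx zu zu' zv zv'].
  rewrite !(@lam_alpha y z) ?mem_filter ?negb_and ?zu ?zu' ?orbT //.
  rewrite !subst_lam //.
  apply: eqred_lam; first by apply: IH => //; lia.
  by apply: (IH); rewrite ?tm_size_rename; [lia|by []|apply: IH => //; [lia|apply: eqred_var]].
Qed.

Lemma eqred_topE w : eqred Top w -> w = Top.
Proof. by move=> h; inversion h. Qed.

(** The derivation may use another bound name [y]. Renaming the reduced body to [x] captures
    nothing, because reduction creates no free variables. *)
Lemma eqred_lamE x t u w : eqred (lam x t u) w ->
  exists t' u', [/\ w = lam x t' u', eqred t t' & eqred u u'].
Proof.
move=> h; inversion h as [| | | | |y t0 t' u0 u' tt' uu' [et eu]]; subst => {h}.
have [-> xP] := close_eq_rename (esym eu).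
exists t', (subst y (FVar x) u'); split=> //.
  apply: lam_alpha; rewrite mem_filter negb_and negbK.
  case: eqP => //= xy; apply/negP => /(eqred_fv uu') /xP //.
by apply: eqred_subst => //; apply: eqred_var.
Qed.

Lemma eqred_appE u v w : eqred (App u v) w ->
  [\/ u = Top /\ w = Top,
      exists u' v', [/\ w = App u' v', eqred u u' & eqred v v'] |
      exists x t b b' v',
        [/\ u = lam x t b, w = subst x v' b', eqred b b' & eqred v v']].
Proof.
move=> h; inversion h; subst => {h}.
- by constructor 1.
- by constructor 2; do 2 eexists; split; eauto.
- by constructor 3; do 5 eexists; split; eauto.
Qed.

Lemma eqred_app_lamE x t u v w : eqred (App (lam x t u) v) w ->
  (exists t' u' v', [/\ w = App (lam x t' u') v', eqred u u' & eqred v v']) \/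
  (exists u' v', [/\ w = subst x v' u', eqred u u' & eqred v v']).
Proof.
case/eqred_appE => [[]//|[r [v' [-> /eqred_lamE[t' [u' [-> _ uu']]] vv']]]|].
  by left; exists t', u', v'.
move=> [y [t0 [b [b' [v' [[_ eb] -> bb' vv']]]]]]; right.
have [-> xP] := close_eq_rename eb.
exists (subst y (FVar x) b'), v'; split=> //.
  by rewrite subst_rename // => /(eqred_fv bb').
by apply: eqred_subst => //; apply: eqred_var.
Qed.

(** This is parallel reduction in the style of Tait and Martin-Löf. When a congruence step meets a
    beta step, the surviving redex is contracted on one side and [eqred_subst] closes the other. *)
Lemma eqred_diamond u a b :
  eqred u a -> eqred u b -> exists2 c, eqred a c & eqred b c.
Proof.
have [k] := ubnP (tm_size u); elim: k u a b => // k IH u0 a b lt_k ua.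
case: ua lt_k => [y||w|u u' v v' uu' vv'|x t u u' v v' uu' vv'|x t t' u u' tt' uu'].
- by move=> _ h; exists b => //; apply: eqred_refl.
- by move=> _ h; exists b => //; apply: eqred_refl.
- move=> _ /eqred_appE[[_ ->]|[c [d [-> /eqred_topE-> _]]]|].
  + by exists Top; apply: eqred_top.
  + by exists Top; [apply: eqred_top|apply: eqred_topapp].
  + by move=> [? [? [? [? [? []]]]]].
- rewrite /= => lt_k /eqred_appE[[eu ->]|[c [d [-> uc vd]]]|].
  + rewrite eu in uu'; rewrite (eqred_topE uu').
    by exists Top; [apply: eqred_topapp|apply: eqred_top].
  + have [|e u'e ce] := IH _ _ _ _ uu' uc; first by lia.
    have [|f v'f df] := IH _ _ _ _ vv' vd; first by lia.
    by exists (App e f); apply: eqred_app.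
  + move=> [x [t [r [r' [d [eu -> rr' vd]]]]]]; subst u.
    move: lt_k; rewrite /= tm_size_close => lt_k.
    have [t' [r'' [-> _ rr'']]] := eqred_lamE uu'.
    have [|e r''e r'e] := IH _ _ _ _ rr'' rr'; first by lia.
    have [|f v'f df] := IH _ _ _ _ vv' vd; first by lia.
    by exists (subst x f e); [apply: eqred_beta|apply: eqred_subst].
- rewrite /= tm_size_close => lt_k.
  (* Whether or not the second step contracts the redex, the same contractum closes the span. *)
  move=> /eqred_app_lamE[[t' [r [d [-> ur vd]]]]|[r [d [-> ur vd]]]];
  (have [|e u'e re] := IH _ _ _ _ uu' ur; first by lia);
  (have [|f v'f df] := IH _ _ _ _ vv' vd; first by lia);
  exists (subst x f e); do ?[exact: eqred_subst|exact: eqred_beta].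
- rewrite /= tm_size_close => lt_k /eqred_lamE[t'' [u'' [-> tt'' uu'']]].
  have [|e u'e u''e] := IH _ _ _ _ uu' uu''; first by lia.
  have [|f t'f t''f] := IH _ _ _ _ tt' tt''; first by lia.
  by exists (lam x f e); apply: eqred_lam.
Qed.

(** * Extended contexts *)

Lemma prevalid_nil G s : prevalid G s -> prevalid G [::].
Proof. by elim=> // *; constructor. Qed.

Lemma prevalid_consE G a s :
  prevalid G (a :: s) -> prevalid G s /\ {subset fv a <= dom G}.
Proof. by move=> h; inversion h; subst. Qed.

Lemma prevalid_ctxE G x t s : prevalid ((x, t) :: G) s ->
  [/\ prevalid G [::], x \notin dom G & {subset fv t <= dom G}].
Proof. by move/prevalid_nil => h; inversion h; subst. Qed.

Lemma mem_dom x t (G : ctx) : List.In (x, t) G -> x \in dom G.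
Proof.
elim: G => //= -[y r] G IH [[-> _]|/IH]; first by rewrite inE eqxx.
by rewrite inE => ->; rewrite orbT.
Qed.

Lemma prevalid_fv G s x t : prevalid G s -> List.In (x, t) G ->
  {subset fv t <= dom G}.
Proof.
elim=> // {}G y r _ IH _ rG [[_ <-]|/IH sG] z.
  by move/rG; rewrite inE => ->; rewrite orbT.
by move/sG; rewrite inE => ->; rewrite orbT.
Qed.

Lemma prevalid_pop_ctx G x t s : all (fun b : term => x \notin fv b) s ->
  prevalid ((x, t) :: G) s -> prevalid G s.
Proof.
elim: s => [_ /prevalid_ctxE[]//|a s IH /= /andP[xa xs] /prevalid_consE[pv aG]].
apply: pv_stack; first exact: IH.
move=> y ya; have := aG _ ya; rewrite inE => /orP[/eqP /= yx|//].
by rewrite -yx ya in xa.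
Qed.

(** (Prom), (Top) and (Eq) check prevalidity; the other rules inherit it by inverting that of their
    premise, where (FunOp) relies on its freshness condition for the rest of the stack. *)
Lemma subred_prevalid G s u v : subred G s u v -> prevalid G s.
Proof.
elim=> {G s u v} //.
- by move=> G s u u' v _ /prevalid_consE[].
- move=> G s x a t u u' xs _ pv; have [_ _ aG] := prevalid_ctxE pv.
  by apply: pv_stack => //; apply: prevalid_pop_ctx pv.
- by move=> G x t u u' _ /prevalid_ctxE[].
Qed.

Lemma ectxred_dom G s G' s' : ectxred G s G' s' -> dom G' = dom G.
Proof. by elim=> //= {}G {}s {}G' {}s' x t t' _ ->. Qed.

Lemma ectxred_in G s G' s' x t : ectxred G s G' s' -> List.In (x, t) G ->
  exists2 t', List.In (x, t') G' & eqred t t'.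
Proof.
elim=> [{}G _ xG|{}G {}s {}G' {}s' y r r' _ IH rr'|//].
  by exists t => //; apply: eqred_refl.
move=> /= [[-> <-]|/IH[t' xt' tt']]; first by exists r' => //; left.
by exists t' => //; right.
Qed.

Lemma ectxred_fresh G s G' s' x : ectxred G s G' s' ->
  all (fun b : term => x \notin fv b) s ->
  all (fun b : term => x \notin fv b) s'.
Proof.
elim=> // {}G {}s {}G' {}s' a a' _ IH aa' /= /andP[xa /IH->].
by rewrite andbT; apply: contra xa => /(eqred_fv aa').
Qed.

Lemma ectxred_nilE G G' s' : ectxred G [::] G' s' -> s' = [::].
Proof. by move e: [::] => s h; elim: h e. Qed.

(** Annotation and stack steps may interleave, so the step on the head can be buried under
    annotation steps; the induction brings it out. *)
Lemma ectxred_consE G a s G' s0 : ectxred G (a :: s) G' s0 ->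
  exists a' s', [/\ s0 = a' :: s', eqred a a' & ectxred G s G' s'].
Proof.
move e: (a :: s) => s1 h; elim: h e => {G G' s0 s1}.
- by move=> G s1 <-; exists a, s; split=> //; [apply: eqred_refl|apply: ectxred_refl].
- move=> G s1 G' s1' x t t' _ IH tt' /IH[a' [s' [-> aa' red]]].
  by exists a', s'; split=> //; apply: ectxred_ctx.
- by move=> G s1 G' s1' b b' red _ bb' [-> ->]; exists b', s1'.
Qed.

(** Reduction keeps the domain and creates no free variables. *)
Lemma ectxred_prevalid G s G' s' :
  ectxred G s G' s' -> prevalid G s -> prevalid G' s'.
Proof.
move=> red pv; elim: pv G' s' red => {G s}.
- by move=> G' s' h; inversion h; subst; apply: pv_empty.
- move=> G x t pv IH xG tG G' s' h; inversion h as [|? ? G0 ? ? ? t' red tt'|];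
    subst; first exact: pv_ctx.
  have es := ectxred_nilE red; subst.
  apply: pv_ctx; [exact: IH|by rewrite (ectxred_dom red)|].
  by rewrite (ectxred_dom red) => y /(eqred_fv tt') /tG.
- move=> G s a pv IH aG G' s0 /ectxred_consE[a' [s' [-> aa' red]]].
  apply: pv_stack; first exact: IH.
  by rewrite (ectxred_dom red) => y /(eqred_fv aa') /aG.
Qed.

(** * Substituting a variable by its bound *)

Definition subst_ctx x v (G : ctx) : ctx := [seq (p.1, subst x v p.2) | p <- G].
Definition subst_stack x v (s : stack) : stack := [seq subst x v a | a <- s].

Lemma mem_subst_ctx_dom x a D G y :
  (y \in dom (subst_ctx x a D ++ G)) = (y \in dom D) || (y \in dom G).
Proof. by rewrite /dom map_cat mem_cat -map_comp. Qed.

Lemma mem_dom_bound D x a G y :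
  (y \in dom (D ++ (x, a) :: G)) = [|| y \in dom D, y == x | y \in dom G].
Proof. by rewrite /dom map_cat mem_cat /= in_cons. Qed.

Lemma fv_subst_bound x a D G (t : term) : {subset fv a <= dom G} ->
  {subset fv t <= dom (D ++ (x, a) :: G)} ->
  {subset fv (subst x a t) <= dom (subst_ctx x a D ++ G)}.
Proof.
move=> aG tG y; rewrite mem_subst_ctx_dom => /fv_subst[/aG->|[/tG yD yx]].
  by rewrite orbT.
by move: yD; rewrite mem_dom_bound (negbTE yx).
Qed.

Lemma prevalid_bound D x a G s : prevalid (D ++ (x, a) :: G) s ->
  [/\ prevalid G [::], x \notin dom G, {subset fv a <= dom G} & x \notin dom D].
Proof.
move/prevalid_nil; elim: D => [/prevalid_ctxE[]//|[y t] D IH].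
move=> /prevalid_ctxE[/IH[pv xG aG xD] yD _]; split=> //.
rewrite mem_dom_bound !negb_or in yD; have /and3P[_ yx _] := yD.
by rewrite [dom _]/= in_cons negb_or eq_sym yx.
Qed.

Lemma prevalid_subst D x a G s : prevalid (D ++ (x, a) :: G) s ->
  prevalid (subst_ctx x a D ++ G) (subst_stack x a s).
Proof.
move=> pv; have [pvG xG aG _] := prevalid_bound pv.
elim: s pv => [|b s IH] pv; last first.
  have [pvs bG] := prevalid_consE pv.
  by apply: pv_stack; [exact: IH|exact: fv_subst_bound].
elim: D pv => [//|[y t] D IH] /prevalid_ctxE[pv yD tD].
apply: pv_ctx; [exact: IH| |exact: fv_subst_bound].
move: yD; rewrite mem_subst_ctx_dom mem_dom_bound.
by apply: contra => /orP[]->; rewrite ?orbT.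
Qed.

(** [D] holds the annotations made after [x]; it must be arbitrary because (FunOp) and (Fun) extend
    the context at that end. Annotations in [G] stay as they are, since prevalidity keeps [x] out of
    them. *)
Lemma subred_subst D x a G s u w : subred (D ++ (x, a) :: G) s u w ->
  subred (subst_ctx x a D ++ G) (subst_stack x a s) (subst x a u) (subst x a w).
Proof.
move e: (D ++ (x, a) :: G) => G0 h; elim: h D e => {G0 s u w}.
- move=> G0 s y t pv yt D e; subst G0; have [pvG xG aG xD] := prevalid_bound pv.
  have pv' := prevalid_subst pv.
  case: (List.in_app_or _ _ _ yt) => [yD|/=[[<- <-]|yG]].
  + have /negbTE yx : y != x by apply: contra xD => /eqP<-; apply: mem_dom yD.
    rewrite /= yx; apply: subred_prom => //; apply/List.in_or_app; left.
    exact: (List.in_map (fun p : var * term => (p.1, subst x a p.2)) _ _ yD).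
  (* Here [x] itself is promoted: both sides become [a], in which [x] is not free. *)
  + apply: subred_eq => //; rewrite [subst x a a]subst_fresh.
      by rewrite /= eqxx widen_tm_id; apply: eqred_refl.
    by apply: contra xG => /aG.
  + have /negbTE yx : y != x by apply: contra xG => /eqP<-; apply: mem_dom yG.
    rewrite /= yx subst_fresh; last by apply: contra xG => /(prevalid_fv pvG yG).
    by apply: subred_prom => //; apply/List.in_or_app; right.
- by move=> G0 s u pv D e; subst G0; apply: subred_top; apply: prevalid_subst.
- move=> G0 s u v pv uv D e; subst G0; apply: subred_eq; first exact: prevalid_subst.
  by apply: eqred_subst => //; apply: eqred_refl.
- by move=> G0 s u u' v _ IH D e; apply: subred_app; apply: (IH D).
- move=> G0 s y b t u u' ys red IH D e; subst G0.
  have /prevalid_ctxE[pv yD _] := subred_prevalid red.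
  have [_ _ aG _] := prevalid_bound pv.
  move: yD; rewrite mem_dom_bound !negb_or => /and3P[_ yx yG].
  have ya : y \notin fv a by apply: contra yG => /aG.
  rewrite !subst_lam //; apply: subred_funop; last exact: (IH ((y, b) :: D)).
  rewrite all_map; apply: sub_all ys => c /= yc.
  by apply/negP => /fv_subst[/(negP ya)|[/(negP yc)]].
- move=> G0 y t u u' red IH D e; subst G0.
  have /prevalid_ctxE[pv yD _] := subred_prevalid red.
  have [_ _ aG _] := prevalid_bound pv.
  move: yD; rewrite mem_dom_bound !negb_or => /and3P[_ yx yG].
  have ya : y \notin fv a by apply: contra yG => /aG.
  by rewrite !subst_lam //; apply: subred_fun; apply: (IH ((y, t) :: D)).
Qed.

(** The form needed at a beta step: the freshness required by (FunOp) leaves the remaining stack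
    unchanged. *)
Lemma subred_subst_head x a G s u w : all (fun b : term => x \notin fv b) s ->
  subred ((x, a) :: G) s u w -> subred G s (subst x a u) (subst x a w).
Proof.
move=> xs /(@subred_subst [::]); suff -> : subst_stack x a s = s by [].
by elim: s xs => //= b s IH /andP[xb /IH->]; rewrite subst_fresh.
Qed.

(** * Commutation of equivalence and subtyping reduction *)

Theorem theorem4p5 (G : ctx) (s : stack) (t0 t1 t2 : term) :
  eqred t0 t1 ->
  subred G s t0 t2 ->
  forall (G' : ctx) (s' : stack),
    ectxred G s G' s' ->
    exists t3 : term, eqred t2 t3 /\ subred G' s' t1 t3.
Proof.
have [k] := ubnP (tm_size t0).
(* The extended context varies too: (App) lengthens the stack, and (FunOp) moves its head into the
   context. *)
elim: k G s t0 t1 t2 => // k IH G s t0 t1 t2 lt_k red01 red02 G' s' redG.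
have pv' := ectxred_prevalid redG (subred_prevalid red02).
case: red02 lt_k red01 redG => {G s t0 t2}.
- move=> G s x t _ xt _ red01 redG; inversion red01; subst.
  have [t' xt' tt'] := ectxred_in redG xt.
  by exists t'; split=> //; apply: subred_prom.
- by move=> *; exists Top; split; [apply: eqred_top|apply: subred_top].
- move=> G s u v _ uv _ ut1 _; have [c t1c vc] := eqred_diamond ut1 uv.
  by exists c; split=> //; apply: subred_eq.
- move=> G s u u2 v red lt_k red01 redG; rewrite /= in lt_k.
  case/eqred_appE: red01 => [[eu ->]|[u' [v' [-> uu' vv']]]|].
  + have -> : u2 = Top by subst u; inversion red; subst=> //; apply: eqred_topE.
    by exists Top; split; [apply: eqred_topapp|apply: subred_top].
  + have [|u3 [u23 red3]] := IH _ _ _ _ _ _ uu' red _ _ (ectxred_stack redG vv').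
      by lia.
    by exists (App u3 v'); split; [apply: eqred_app|apply: subred_app].
  + move=> [x [t [b [b' [v' [eu -> bb' vv']]]]]].
    have bred : eqred (App u v) (subst x v' b') by rewrite eu; apply: eqred_beta.
    (* An abstraction facing the nonempty stack [v :: s] can move only by (Top), (Eq) or (FunOp). *)
    inversion red as [|G0 s0 u0 pv|G0 s0 u0 u1 pv uu2| |G0 s0 y a r c c' ys cred|];
      subst=> //.
    * by exists Top; split; [apply: eqred_topapp|apply: subred_top].
    (* Both steps are now equivalence steps from [App u v], so the diamond property applies. *)
    * have bred2 := eqred_app uu2 (eqred_refl v).
      have [w w1 w2] := eqred_diamond bred bred2.
      by exists w; split=> //; apply: subred_eq.
    * have eu : lam x t b = lam y r c by [].
      rewrite eu /= tm_size_close in lt_k.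
      (* the contractum at the name used by (FunOp) *)
      have [c1 [ec cc1]] : exists c1, subst x v' b' = subst y v' c1 /\ eqred c c1.
        have [ec xP] : c = subst x (FVar y) b /\ (y \in fv b -> y = x).
          by apply: close_eq_rename; case: eu.
        exists (subst x (FVar y) b'); rewrite ec; split.
          by rewrite subst_rename // => /(eqred_fv bb').
        by apply: eqred_subst => //; apply: eqred_var.
      have [|c3 [c23 red3]] := IH _ _ _ _ _ _ cc1 cred _ _ (ectxred_ctx y redG vv').
        by lia.
      (* The redex survives in [App (lam y r c') v]; contracting it gives this term, and
         substituting the bound [v'] for [y] in [red3] gives the other side. *)
      exists (subst y v' c3); split; first exact: eqred_beta.
      rewrite ec; apply: subred_subst_head => //; exact: ectxred_fresh redG ys.
- move=> G s x a t u u2 xs red lt_k /eqred_lamE[t' [u' [-> tt' uu']]].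
  rewrite /= tm_size_close in lt_k.
  move=> /ectxred_consE[a' [s1 [es aa' redG]]]; subst s'.
  (* The body is annotated by the popped [a], not by [t], so the stack step from [a] to [a'] becomes
     the annotation step. *)
  have [|u3 [u23 red3]] := IH _ _ _ _ _ _ uu' red _ _ (ectxred_ctx x redG aa').
    by lia.
  exists (lam x t' u3); split; first exact: eqred_lam.
  by apply: subred_funop => //; apply: ectxred_fresh redG xs.
- move=> G x t u u2 red lt_k /eqred_lamE[t' [u' [-> tt' uu']]] redG.
  rewrite /= tm_size_close in lt_k; have es := ectxred_nilE redG; subst s'.
  have [|u3 [u23 red3]] := IH _ _ _ _ _ _ uu' red _ _ (ectxred_ctx x redG tt').
    by lia.
  by exists (lam x t' u3); split; [apply: eqred_lam|apply: subred_fun].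
Qed.
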